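(* Let $A=\bigoplus_{n\geq 0}A_n$ be a tower of algebras over $\mathbb{C}$ (in the sense defined in the context) such that its associated Grothendieck groups $G(A)$ and $K(A)$, with the induction product, restriction coproduct and pairing described in the context, form a pair of graded dual Hopf algebras. Then for every $n\geq 0$, $$\dim(A_n)=r^n\, n!,\qquad\text{where } r=\dim(A_1).$$
   Context: A graded algebra $A=\bigoplus_{n\ge0}A_n$ over $\mathbb{C}$ with (external) multiplication $\rho$ is a tower of algebras if: (1) each $A_n$ is a finite-dimensional algebra with its own (internal) multiplication and unit $1_n$, and $A_0\cong\mathbb{C}$; (2) each external multiplication $\rho_{m,n}:A_m\otimes A_n\to A_{m+n}$ is an injective algebra homomorphism sending $1_m\otimes 1_n$ to $1_{m+n}$; (3) $A_{m+n}$ is a two-sided projective $A_m\otimes A_n$-module via $a\cdot(b\otimes c)=a\rho_{m,n}(b\otimes c)$ and $(b\otimes c)\cdot a=\rho_{m,n}(b\otimes c)a$. For a finite-dimensional algebra $B$, $G_0(B)$ is the Grothendieck group of finitely generated left $B$-modules (free on the classes $[V]$ of the simple modules) and $K_0(B)$ is the Grothendieck group of finitely generated projective left $B$-modules (free on the classes $[P]$ of the indecomposable projectives, i.e. projective covers of the simples). Set $G(A)=\bigoplus_{n\ge0}G_0(A_n)$ and $K(A)=\bigoplus_{n\ge0}K_0(A_n)$. On each, define a product by $[M][N]=[\mathrm{Ind}_{A_m\otimes A_n}^{A_{m+n}}M\otimes N]$ for $[M]$ in degree $m$ and $[N]$ in degree $n$ (induction along $\rho_{m,n}$, i.e. $A_{m+n}\otimes_{A_m\otimes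 A_n}(M\otimes N)$), and a coproduct by $\Delta([N])=\sum_{k+l=n}[\mathrm{Res}^{A_{k+l}}_{A_k\otimes A_l}N]$ for $[N]$ in degree $n$ (restriction along $\rho_{k,l}$). The pairing $K(A)\times G(A)\to\mathbb{Z}$ is $\langle [P],[M]\rangle=\dim_{\mathbb{C}}\mathrm{Hom}_{A_n}(P,M)$ if $[P]\in K_0(A_n)$ and $[M]\in G_0(A_n)$, and $0$ if they lie in different degrees. ''Form a pair of graded dual Hopf algebras'' means that with these operations $G(A)$ and $K(A)$ are graded Hopf algebras which are dual to each other under this pairing (product of one is dual to coproduct of the other). *)

(* Defs.v *)
From HB Require Import structures.
From mathcomp Require Import all_boot all_order all_algebra.
From mathcomp Require Import boolp reals.
From mathcomp Require Import complex freeg.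

Set Implicit Arguments.
Unset Strict Implicit.
Unset Printing Implicit Defensive.

Import GRing.Theory.
Import passmx.

Local Open Scope ring_scope.
Local Open Scope quotient_scope.

Section Zspan.
Variables (V : zmodType) (S : V -> Prop).

(* The subgroup of V generated by S. *)
Definition zspan (x : V) : Prop :=
  forall P : V -> Prop, P 0 -> (forall y z, P y -> P z -> P (y - z)) ->
    (forall y, S y -> P y) -> P x.

Definition zspanb : {pred V} := [pred x | `[< zspan x >]].

Lemma zspanb_closed : zmod_closed zspanb.
Proof.
split=> [|x y]; rewrite !inE; first by apply/asboolP => P.
move=> /asboolP Hx /asboolP Hy; apply/asboolP => P P0 PB PS.
exact: PB (Hx P P0 PB PS) (Hy P P0 PB PS).
Qed.

HB.instance Definition _ := GRing.isZmodClosed.Build V zspanb zspanb_closed.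
End Zspan.

Section FreeExtension.
Variables (X : choiceType) (W : zmodType) (f : X -> W).

(* The homomorphism of abelian groups {freeg X} -> W extending f. *)
Definition fgext (D : {freeg X}) : W := fglift (f : X -> zmodule W) D.

Lemma fgext_additive : zmod_morphism fgext.
Proof. exact: (lift_is_additive (f : X -> zmodule W)). Qed.
HB.instance Definition _ :=
  GRing.isZmodMorphism.Build {freeg X} W fgext fgext_additive.

Lemma fgextU x : fgext << x >> = f x.
Proof. by rewrite /fgext liftU scale1r. Qed.
End FreeExtension.

Section Presentation.
Variables (X : choiceType) (S : {freeg X} -> Prop).

(* The abelian group with generators X and relations r = 0 for S r. *)
Definition pres : zmodType := Quotient.quot (zspanb S : zmodClosed {freeg X}).

Definition pres_gen (x : X) : pres := \pi_pres << x >>.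

(* The homomorphism pres -> W sending each generator x to f x; it is
   meaningful only if f respects the relations S. *)
Definition pres_lift (W : zmodType) (f : X -> W) (u : pres) : W :=
  fgext f (repr u).

Section PresLift.
Variables (W : zmodType) (f : X -> W).
Hypothesis fS : forall r, S r -> fgext f r = 0.

Lemma pres_lift_pi D : pres_lift f (\pi_pres D) = fgext f D.
Proof.
apply/eqP; rewrite -subr_eq0 -raddfB; apply/eqP.
have : repr (\pi_pres D) - D \in zspanb S.
  by have := reprK (\pi_pres D); move/eqP; rewrite -Quotient.idealrBE.
rewrite inE => /asboolP /(_ (fun D => fgext f D = 0)); apply=> // [|y z].
  exact: raddf0.
by move=> hy hz; rewrite raddfB /= hy hz subr0.
Qed.

Lemma pres_lift_additive : zmod_morphism (pres_lift f).
Proof.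
move=> u v; rewrite -[u]reprK -[v]reprK -raddfB !pres_lift_pi.
exact: raddfB.
Qed.

Lemma pres_lift_gen x : pres_lift f (pres_gen x) = f x.
Proof. by rewrite pres_lift_pi fgextU. Qed.
End PresLift.
End Presentation.

Section TensorZ.
Variables U V : zmodType.

Variant tens_rel : {freeg (U * V)%type} -> Prop :=
| TensDl u u' v : tens_rel (<< (u + u', v) >> - << (u, v) >> - << (u', v) >>)
| TensDr u v v' : tens_rel (<< (u, v + v') >> - << (u, v) >> - << (u, v') >>).

Definition tens : zmodType := pres tens_rel.

Definition tpure (u : U) (v : V) : tens := pres_gen tens_rel (u, v).

(* The homomorphism induced by a biadditive f. *)
Definition tlift (W : zmodType) (f : U -> V -> W) : tens -> W :=
  pres_lift (fun p => f p.1 p.2).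
End TensorZ.

Definition biadditive (U V W : zmodType) (f : U -> V -> W) : Prop :=
  (forall u, zmod_morphism (f u)) /\ (forall v, zmod_morphism (f^~ v)).

Section TensorZTheory.
Variables (U V W : zmodType) (f : U -> V -> W).
Hypothesis fP : biadditive f.

Lemma tens_relP (r : {freeg (U * V)%type}) : tens_rel r ->
  fgext (fun p => f p.1 p.2) r = 0.
Proof.
have morD (A B : zmodType) (g : A -> B) : zmod_morphism g -> {morph g : x y / x + y}.
  move=> gB x y; have g0 : g 0 = 0 by rewrite -(subrr 0) gB subrr.
  by rewrite -{1}[y]opprK gB -[- y]sub0r gB g0 sub0r opprK.
case: fP => fr fl; case=> *; rewrite !raddfB /= !fgextU /=.
  by rewrite (morD _ _ _ (fl _)) addrAC addrK subrr.
by rewrite (morD _ _ _ (fr _)) addrAC addrK subrr.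
Qed.

Lemma tlift_additive : zmod_morphism (tlift f).
Proof. exact: pres_lift_additive tens_relP. Qed.

Lemma tlift_pure u v : tlift f (tpure u v) = f u v.
Proof. exact: pres_lift_gen tens_relP _. Qed.
End TensorZTheory.

Definition tmap (U V U' V' : zmodType) (f : U -> U') (g : V -> V') :
    tens U V -> tens U' V' :=
  tlift (fun u v => tpure (f u) (g v)).

Definition tassoc (U V W : zmodType) (t : tens (tens U V) W) :
    tens U (tens V W) :=
  tlift (fun s w => tlift (fun u v => tpure u (tpure v w)) s) t.

Section DirectSum.
Variable G : nat -> zmodType.

Record dsum : Type := Dsum {
  dsum_fun :> forall n, G n;
  dsum_fin : exists N, forall n, (N <= n)%N -> dsum_fun n = 0 }.

HB.instance Definition _ := gen_eqMixin dsum.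
HB.instance Definition _ := gen_choiceMixin dsum.

Lemma dsum_inj (x y : dsum) : (forall n, x n = y n) -> x = y.
Proof.
case: x y => [x hx] [y hy] /= exy.
have {}exy : x = y by apply: functional_extensionality_dep.
by case: y / exy hy => hy; congr Dsum; apply: Prop_irrelevance.
Qed.

Lemma dsum0_fin : exists N, forall n, (N <= n)%N -> (0 : G n) = 0.
Proof. by exists 0. Qed.
Definition dsum0 := Dsum dsum0_fin.

Lemma dsumN_fin (x : dsum) : exists N, forall n, (N <= n)%N -> - x n = 0.
Proof. by case: (dsum_fin x) => N h; exists N => n /h ->; rewrite oppr0. Qed.
Definition dsumN x := Dsum (dsumN_fin x).

Lemma dsumD_fin (x y : dsum) : exists N, forall n, (N <= n)%N -> x n + y n = 0.
Proof.
case: (dsum_fin x) (dsum_fin y) => N h [N' h']; exists (maxn N N') => n.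
by rewrite geq_max => /andP[/h -> /h' ->]; rewrite addr0.
Qed.
Definition dsumD x y := Dsum (dsumD_fin x y).

Lemma dsum_addA : associative dsumD.
Proof. by move=> x y z; apply: dsum_inj => n /=; rewrite addrA. Qed.
Lemma dsum_addC : commutative dsumD.
Proof. by move=> x y; apply: dsum_inj => n /=; rewrite addrC. Qed.
Lemma dsum_add0 : left_id dsum0 dsumD.
Proof. by move=> x; apply: dsum_inj => n /=; rewrite add0r. Qed.
Lemma dsum_addN : left_inverse dsum0 dsumN dsumD.
Proof. by move=> x; apply: dsum_inj => n /=; rewrite addNr. Qed.

HB.instance Definition _ :=
  GRing.isZmodule.Build dsum dsum_addA dsum_addC dsum_add0 dsum_addN.

Lemma dsum_in_fin n (x : G n) :
  exists N, forall m, (N <= m)%N -> dfwith (fun k => 0 : G k) x m = 0.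
Proof.
exists n.+1 => m lt_nm; rewrite dfwith_out //.
by rewrite neq_ltn lt_nm.
Qed.

Definition dsum_in n (x : G n) : dsum := Dsum (dsum_in_fin x).
End DirectSum.

Record hopf_data (H : zmodType) := HopfData {
  hmul : H -> H -> H;
  hone : H;
  hcomul : H -> tens H H;
  hcounit : H -> int;
  hantipode : H -> H }.

Definition tens_mul (H : zmodType) (mul : H -> H -> H) (s t : tens H H) :
    tens H H :=
  tlift (fun a b => tlift (fun c d => tpure (mul a c) (mul b d)) t) s.

Record is_hopf (H : zmodType) (D : hopf_data H) : Prop := IsHopf {
  hopf_mulD : biadditive (hmul D);
  hopf_mulA : associative (hmul D);
  hopf_mul1l : left_id (hone D) (hmul D);
  hopf_mul1r : right_id (hone D) (hmul D);
  hopf_comulD : zmod_morphism (hcomul D);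
  hopf_comulA : forall x,
    tassoc (tmap (hcomul D) id (hcomul D x)) = tmap id (hcomul D) (hcomul D x);
  hopf_counitD : zmod_morphism (hcounit D);
  hopf_counitl : forall x,
    tlift (fun a b => b *~ hcounit D a) (hcomul D x) = x;
  hopf_counitr : forall x,
    tlift (fun a b => a *~ hcounit D b) (hcomul D x) = x;
  hopf_comulM : forall x y,
    hcomul D (hmul D x y) = tens_mul (hmul D) (hcomul D x) (hcomul D y);
  hopf_comul1 : hcomul D (hone D) = tpure (hone D) (hone D);
  hopf_counitM : forall x y,
    hcounit D (hmul D x y) = hcounit D x * hcounit D y;
  hopf_counit1 : hcounit D (hone D) = 1;
  hopf_antipodeD : zmod_morphism (hantipode D);
  hopf_antipodel : forall x,
    tlift (fun a b => hmul D (hantipode D a) b) (hcomul D x)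
    = hone D *~ hcounit D x;
  hopf_antipoder : forall x,
    tlift (fun a b => hmul D a (hantipode D b)) (hcomul D x)
    = hone D *~ hcounit D x }.

Record is_graded_hopf (H : nat -> zmodType) (D : hopf_data (dsum H)) : Prop :=
  IsGradedHopf {
  ghopf_hopf : is_hopf D;
  ghopf_mul : forall m n (x : H m) (y : H n),
    exists z : H (m + n)%N, hmul D (dsum_in x) (dsum_in y) = dsum_in z;
  ghopf_one : exists z : H 0%N, hone D = dsum_in z;
  ghopf_comul : forall n (x : H n),
    zspan (fun t => exists k l (a : H k) (b : H l),
                      (k + l)%N = n /\ t = tpure (dsum_in a) (dsum_in b))
          (hcomul D (dsum_in x));
  ghopf_counit : forall n (x : H n), (0 < n)%N -> hcounit D (dsum_in x) = 0;
  ghopf_antipode : forall n (x : H n),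
    exists z : H n, hantipode D (dsum_in x) = dsum_in z }.

(* <x (x) y, a (x) b> = <x, a> <y, b>, extended biadditively. *)
Definition tens_pairing (U V : zmodType) (pr : U -> V -> int)
    (s : tens U U) (t : tens V V) : int :=
  tlift (fun x y => tlift (fun a b => pr x a * pr y b) t) s.

(* Perfectness of the pairing in each degree says that each of the two groups
   is the graded dual of the other. *)
Record is_graded_dual (H H' : nat -> zmodType)
    (D : hopf_data (dsum H)) (D' : hopf_data (dsum H'))
    (pr : dsum H -> dsum H' -> int) : Prop := IsGradedDual {
  gdual_biadd : biadditive pr;
  gdual_perfectl : forall n (f : H' n -> int), zmod_morphism f ->
    exists! x : H n, forall y, pr (dsum_in x) (dsum_in y) = f y;
  gdual_perfectr : forall n (f : H n -> int), zmod_morphism f ->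
    exists! y : H' n, forall x, pr (dsum_in x) (dsum_in y) = f x;
  gdual_mul : forall x x' y,
    pr (hmul D x x') y = tens_pairing pr (tpure x x') (hcomul D' y);
  gdual_comul : forall x y y',
    pr x (hmul D' y y') = tens_pairing pr (hcomul D x) (tpure y y');
  gdual_one : forall y, pr (hone D) y = hcounit D' y;
  gdual_counit : forall x, pr x (hone D') = hcounit D x;
  gdual_antipode : forall x y, pr (hantipode D x) y = pr x (hantipode D' y) }.

Definition bilinear_map (K : fieldType) (U V W : lmodType K)
    (f : U -> V -> W) : Prop :=
  (forall u, linear (f u)) /\ (forall v, linear (f^~ v)).

(* Unlike falgType, this allows the zero algebra. *)
Record finAlg (K : fieldType) := FinAlg {
  fa_car :> vectType K;
  fa_mul : fa_car -> fa_car -> fa_car;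
  fa_one : fa_car;
  fa_bilin : bilinear_map fa_mul;
  fa_mulA : associative fa_mul;
  fa_mul1l : left_id fa_one fa_mul;
  fa_mul1r : right_id fa_one fa_mul }.

Arguments fa_mul {K f}.
Arguments fa_one {K f}.

Definition is_alg_hom (K : fieldType) (B B' : finAlg K) (f : B -> B') : Prop :=
  [/\ linear f, f fa_one = fa_one & {morph f : x y / fa_mul x y}].

Section TensorK.
Variable K : fieldType.
Implicit Types U V W : vectType K.

Definition coords V (v : V) : 'rV[K]_(\dim {:V}) := rVof (vbasis {:V}) v.
Definition uncoords V (r : 'rV[K]_(\dim {:V})) : V := vecof (vbasis {:V}) r.

Lemma coords_linear V : linear (@coords V).
Proof. exact: linearP. Qed.
Lemma uncoords_linear V : linear (@uncoords V).
Proof. exact: linearP. Qed.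
Lemma coordsK V : cancel (@coords V) (@uncoords V).
Proof. by apply: rVofK; apply: vbasisP. Qed.
Lemma uncoordsK V : cancel (@uncoords V) (@coords V).
Proof. by apply: vecofK; apply: vbasisP. Qed.

(* A model of the tensor product over K, in coordinates with respect to the
   bases vbasis {:U} and vbasis {:V}. *)
Definition ktens U V : vectType K := 'M[K]_(\dim {:U}, \dim {:V}).

Definition kpure U V (u : U) (v : V) : ktens U V := (coords u)^T *m coords v.

Definition kbase U (i : 'I_(\dim {:U})) : U := (vbasis {:U})`_i.

(* The linear map induced by a bilinear f. *)
Definition klift U V (W : lmodType K) (f : U -> V -> W) (t : ktens U V) : W :=
  \sum_i \sum_j (t : 'M_(_, _)) i j *: f (kbase i) (kbase j).

Lemma kpure_bilin U V : bilinear_map (@kpure U V).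
Proof.
split=> [u c x y|v c x y]; rewrite /kpure coords_linear ?linearP //=.
by rewrite mulmxDl scalemxAl.
Qed.

Lemma kbase_sum U (u : U) : u = \sum_i coords u 0 i *: kbase i.
Proof.
by rewrite -[LHS]coordsK.
Qed.

Lemma klift_linear U V (W : lmodType K) (f : U -> V -> W) : linear (klift f).
Proof.
move=> c s t; rewrite /klift scaler_sumr -big_split; apply: eq_bigr => i _ /=.
rewrite scaler_sumr -big_split; apply: eq_bigr => j _ /=.
by rewrite !mxE scalerDl scalerA.
Qed.

Lemma kliftP U V (W : lmodType K) c (f g : U -> V -> W) t :
  klift (fun u v => c *: f u v + g u v) t = c *: klift f t + klift g t.
Proof.
rewrite /klift scaler_sumr -big_split; apply: eq_bigr => i _ /=.
rewrite scaler_sumr -big_split; apply: eq_bigr => j _ /=.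
by rewrite scalerDr !scalerA mulrC.
Qed.

Lemma linear_sumE (V W : lmodType K) (f : V -> W) : linear f ->
  forall n (c : 'I_n -> K) (F : 'I_n -> V),
    f (\sum_i c i *: F i) = \sum_i c i *: f (F i).
Proof.
move=> lf n c F; pose g := GRing.isLinear.Build _ _ _ _ f lf.
pose h : {linear V -> W} := HB.pack f g.
transitivity (h (\sum_i c i *: F i)) => //; rewrite linear_sum.
by apply: eq_bigr => i _; rewrite linearZ.
Qed.

Lemma kliftE U V (W : lmodType K) (f : U -> V -> W) u v :
  bilinear_map f -> klift f (kpure u v) = f u v.
Proof.
move=> [fr fl]; rewrite [in RHS](kbase_sum u) (linear_sumE (fl v)).
apply: eq_bigr => i _.
rewrite [in RHS](kbase_sum v) (linear_sumE (fr _)) scaler_sumr.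
by apply: eq_bigr => j _; rewrite scalerA !mxE big_ord1 !mxE.
Qed.

Lemma kpure_ext U V (W : lmodType K) (f g : ktens U V -> W) :
  linear f -> linear g -> (forall u v, f (kpure u v) = g (kpure u v)) ->
  forall t, f t = g t.
Proof.
move=> lf lg fg t.
have -> : t = \sum_i \sum_j (t : 'M_(_,_)) i j *: kpure (kbase i) (kbase j).
  rewrite [LHS]matrix_sum_delta; apply: eq_bigr => i _; apply: eq_bigr => j _.
  by rewrite /kpure /kbase /coords !rVofE ?vbasisP// trmx_delta mul_delta_mx.
have E h : linear h -> h (\sum_i \sum_j (t : 'M_(_,_)) i j *:
    kpure (kbase i) (kbase j)) = \sum_i \sum_j (t : 'M_(_,_)) i j *:
    h (kpure (kbase i) (kbase j)) :> W.
  move=> lh.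
  have := linear_sumE lh (fun=> 1).
  move=> /(_ (\dim {:U}) (fun i => \sum_j (t : 'M_(_,_)) i j *: kpure (kbase i) (kbase j))).
  under eq_bigr do rewrite scale1r. move=> ->.
  by apply: eq_bigr => i _; rewrite scale1r (linear_sumE lh).
rewrite !E //; apply: eq_bigr => i _; apply: eq_bigr => j _.
by rewrite fg.
Qed.

(* (u (x) v, x (x) y) |-> f u x (x) g v y, extended bilinearly. *)
Definition kact U V (X X' Y Y' : vectType K) (f : U -> X -> X')
    (g : V -> Y -> Y') (s : ktens U V) (t : ktens X Y) : ktens X' Y' :=
  klift (fun u v => klift (fun x y => kpure (f u x) (g v y)) t) s.

Section Kact.
Variables (U V X X' Y Y' : vectType K).
Variables (f : U -> X -> X') (g : V -> Y -> Y').
Hypotheses (bf : bilinear_map f) (bg : bilinear_map g).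

Lemma kact_inner u v : bilinear_map (fun x y => kpure (f u x) (g v y)).
Proof.
case: (kpure_bilin X' Y') => kr kl.
by split=> [x|y] c a b; rewrite ?bf.1 ?bg.1 ?kr ?kl.
Qed.

Lemma kact_outer t :
  bilinear_map (fun u v => klift (fun x y => kpure (f u x) (g v y)) t).
Proof.
case: (kpure_bilin X' Y') => kr kl.
split=> [u|v] c a b; rewrite -kliftP /klift.
  by apply: eq_bigr => i _; apply: eq_bigr => j _; rewrite bg.2 kr.
by apply: eq_bigr => i _; apply: eq_bigr => j _; rewrite bf.2 kl.
Qed.

Lemma kact_bilin : bilinear_map (kact f g).
Proof.
split=> [s|t]; last exact: klift_linear.
move=> c a b; rewrite /kact -kliftP; congr klift.
by apply/funext => u; apply/funext => v; rewrite klift_linear.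
Qed.

Lemma kactE u v x y :
  kact f g (kpure u v) (kpure x y) = kpure (f u x) (g v y).
Proof.
by rewrite /kact kliftE ?kliftE //; [exact: kact_inner|exact: kact_outer].
Qed.
End Kact.

Section TensorAlgebra.
Variables A B : finAlg K.

Definition ta_mul : ktens A B -> ktens A B -> ktens A B :=
  kact (@fa_mul K A) (@fa_mul K B).
Definition ta_one : ktens A B := kpure fa_one fa_one.

Lemma ta_bilin : bilinear_map ta_mul.
Proof. exact: kact_bilin. Qed.

Lemma ta_mulE a b a' b' :
  ta_mul (kpure a b) (kpure a' b') = kpure (fa_mul a a') (fa_mul b b').
Proof. exact: kactE (fa_bilin A) (fa_bilin B) _ _ _ _. Qed.

Lemma ta_mulA : associative ta_mul.
Proof.
case: ta_bilin => mr ml r s t.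
apply: (kpure_ext (f := fun r => ta_mul r (ta_mul s t))
                  (g := fun r => ta_mul (ta_mul r s) t)).
- exact: ml.
- by move=> c x y; rewrite !ml.
move=> a b.
apply: (kpure_ext (f := fun s => ta_mul (kpure a b) (ta_mul s t))
                  (g := fun s => ta_mul (ta_mul (kpure a b) s) t)).
- by move=> c x y; rewrite ml mr.
- by move=> c x y; rewrite mr ml.
move=> a' b'.
apply: (kpure_ext (f := fun t => ta_mul (kpure a b) (ta_mul (kpure a' b') t))
                  (g := fun t => ta_mul (ta_mul (kpure a b) (kpure a' b')) t)).
- by move=> c x y; rewrite !mr.
- exact: mr.
by move=> a'' b''; rewrite !ta_mulE !fa_mulA.
Qed.

Lemma ta_mul1l : left_id ta_one ta_mul.
Proof.
apply: (kpure_ext (g := id)) => //; first exact: ta_bilin.1.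
by move=> a b; rewrite ta_mulE !fa_mul1l.
Qed.

Lemma ta_mul1r : right_id ta_one ta_mul.
Proof.
apply: (kpure_ext (f := ta_mul^~ ta_one) (g := id)) => //.
  exact: ta_bilin.2.
by move=> a b /=; rewrite ta_mulE !fa_mul1r.
Qed.

Definition tens_alg : finAlg K :=
  FinAlg ta_bilin ta_mulA ta_mul1l ta_mul1r.
End TensorAlgebra.

Section OppositeAlgebra.
Variable A : finAlg K.

Lemma opp_bilin : bilinear_map (fun x y : A => fa_mul y x).
Proof. by split=> a; [exact: (fa_bilin A).2|exact: (fa_bilin A).1]. Qed.
Lemma opp_mulA : associative (fun x y : A => fa_mul y x).
Proof. by move=> x y z; rewrite fa_mulA. Qed.

Definition opp_alg : finAlg K :=
  FinAlg opp_bilin opp_mulA (@fa_mul1r K A) (@fa_mul1l K A).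
End OppositeAlgebra.

Definition is_action (B : finAlg K) (V : lmodType K) (act : B -> V -> V) :=
  [/\ bilinear_map act, forall x, act fa_one x = x
    & forall a b x, act (fa_mul a b) x = act a (act b x)].

Record module (B : finAlg K) := Module {
  mod_car :> lmodType K;
  mod_act : B -> mod_car -> mod_car;
  mod_actP : is_action mod_act }.

(* A finitely generated left module over a finite-dimensional algebra is
   finite-dimensional over K, hence isomorphic to one with underlying space
   some K^d; restricting to the latter makes these modules form a set. *)
Record fgmod (B : finAlg K) := FgMod {
  fg_dim : nat;
  fg_act : B -> 'rV[K]_fg_dim -> 'rV[K]_fg_dim;
  fg_actP : is_action fg_act }.

Coercion fg_module (B : finAlg K) (M : fgmod B) : module B :=
  Module (fg_actP M).

Section FgOf.
Variables (B : finAlg K) (V : vectType K) (act : B -> V -> V).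
Hypothesis actP : is_action act.

Lemma fg_of_actP : is_action (fun b (x : 'rV_(\dim {:V})) =>
  coords (act b (uncoords x))).
Proof.
case: actP => -[ar al] a1 aM; split.
- by split=> [b|x] c y z /=; rewrite ?uncoords_linear ?ar ?al coords_linear.
- by move=> x; rewrite a1 uncoordsK.
- by move=> a b x; rewrite aM coordsK.
Qed.

(* Transport of a module structure on V to K^(\dim {:V}). *)
Definition fg_of : fgmod B := FgMod fg_of_actP.
End FgOf.

Section ModuleTheory.
Variable B : finAlg K.

Definition is_mod_hom (M N : module B) (f : M -> N) : Prop :=
  linear f /\ forall b x, f (mod_act b x) = mod_act b (f x).

Definition surjective (X Y : Type) (f : X -> Y) : Prop :=
  forall y, exists x, f x = y.

Definition projective (P : module B) : Prop :=
  forall (M N : module B) (g : M -> N) (f : P -> N),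
    is_mod_hom g -> surjective g -> is_mod_hom f ->
    exists h : P -> M, is_mod_hom h /\ forall x, g (h x) = f x.

Definition short_exact (L M N : module B) : Prop :=
  exists (f : L -> M) (g : M -> N),
    [/\ is_mod_hom f, is_mod_hom g, injective f, surjective g
      & forall y, g y = 0 <-> exists x, f x = y].

(* Hom_B(M, N) as the subspace of Hom_K(M, N) of the maps commuting with the
   elements of a basis of B. *)
Definition mod_Hom (M N : fgmod B) :
    {vspace 'Hom('rV[K]_(fg_dim M), 'rV[K]_(fg_dim N))} :=
  (\bigcap_i lker (linfun (fun f : 'Hom('rV[K]_(fg_dim M), 'rV[K]_(fg_dim N)) =>
     ((f \o linfun (@fg_act B M (kbase i)))
      - (linfun (@fg_act B N (kbase i)) \o f))%VF)))%VS.

Lemma linfunE (V W : vectType K) (f : V -> W) : linear f -> linfun f =1 f.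
Proof.
move=> lf x; pose h : {linear V -> W} := HB.pack f (GRing.isLinear.Build _ _ _ _ f lf).
exact: (lfunE h).
Qed.

Lemma mod_HomP (M N : fgmod B) (f : 'Hom(_, _)) :
  f \in mod_Hom M N <-> is_mod_hom (M := M) (N := N) f.
Proof.
have [[Mr Ml] _ _] := fg_actP M; have [[Nr Nl] _ _] := fg_actP N.
have lcomm i : linear (fun f : 'Hom('rV[K]_(fg_dim M), 'rV[K]_(fg_dim N)) =>
     ((f \o linfun (@fg_act B M (kbase i)))
      - (linfun (@fg_act B N (kbase i)) \o f))%VF).
  move=> c g h; rewrite comp_lfunDl comp_lfunDr -comp_lfunZl -comp_lfunZr.
  by rewrite scalerBr opprD addrACA.
have memE : f \in mod_Hom M N <->
    forall i x, f (fg_act (kbase i) x) = fg_act (kbase i) (f x).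
  rewrite /mod_Hom memvE; split=> [/subv_bigcapP h i x|h].
    have := h i isT; rewrite -memvE memv_ker linfunE // subr_eq0 => /eqP.
    by move=> /(congr1 (fun g : 'Hom(_, _) => g x)); rewrite !comp_lfunE !linfunE.
  apply/subv_bigcapP => i _; rewrite -memvE memv_ker linfunE // subr_eq0.
  by apply/eqP/lfunP => x; rewrite !comp_lfunE !linfunE.
rewrite memE; split=> [h|[_ h] i x]; last exact: h.
split=> [|b x /=]; first exact: linearP.
rewrite (kbase_sum b) (linear_sumE (Ml x)) (linear_sumE (Nl (f x))) linear_sum.
by apply: eq_bigr => i _; rewrite linearZ; congr (_ *: _); exact: h.
Qed.
End ModuleTheory.

Section ChangeOfRings.
Variables (B B' : finAlg K) (f : B -> B').
Hypothesis fP : is_alg_hom f.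

Lemma res_actP (V : lmodType K) (act : B' -> V -> V) :
  is_action act -> is_action (fun b => act (f b)).
Proof.
case: fP => lf f1 fM [[ar al] a1 aM]; split.
- by split=> [b|x] c y z /=; rewrite ?lf ?ar ?al.
- by move=> x; rewrite f1.
- by move=> a b x; rewrite fM.
Qed.

Definition res (M : fgmod B') : fgmod B := FgMod (res_actP (fg_actP M)).

Lemma reg_actP (A : finAlg K) : is_action (@fa_mul K A).
Proof. by split; [exact: fa_bilin|exact: fa_mul1l|move=> *; rewrite fa_mulA]. Qed.

(* B' as a left B-module: b . a = f b * a. *)
Definition left_mod : module B := Module (res_actP (reg_actP B')).

Lemma right_actP :
  @is_action (opp_alg B) B' (fun b a => fa_mul a (f b)).
Proof.
case: fP => lf f1 fM; have [mr ml] := fa_bilin B'; split.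
- by split=> [b|x] c y z /=; rewrite ?lf ?mr ?ml.
- by move=> x; rewrite f1 fa_mul1r.
- by move=> a b x /=; rewrite fM fa_mulA.
Qed.

(* B' as a right B-module, i.e., a left module over the opposite algebra of B:
   a . b = a * f b. *)
Definition right_mod : module (opp_alg B) := Module right_actP.

Variant bal_rel (M : fgmod B) :
    {freeg (B' * 'rV[K]_(fg_dim M))%type} -> Prop :=
| BalDl a a' x : bal_rel (<< (a + a', x) >> - << (a, x) >> - << (a', x) >>)
| BalDr a x x' : bal_rel (<< (a, x + x') >> - << (a, x) >> - << (a, x') >>)
| BalM a b x : bal_rel (<< (fa_mul a (f b), x) >> - << (a, fg_act b x) >>).

Definition btens (M : fgmod B) : zmodType := pres (@bal_rel M).

Definition bpure (M : fgmod B) (a : B') (x : M) : btens M :=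
  pres_gen (@bal_rel M) (a, x).

(* W is isomorphic to Ind M = B' (x)_B M, on which B' acts by
   a . (a' (x) x) = a a' (x) x. *)
Definition is_ind (M : fgmod B) (W : fgmod B') : Prop :=
  exists phi : btens M -> W,
    [/\ zmod_morphism phi, bijective phi
      & forall a a' x,
          phi (bpure (fa_mul a a') x) = mod_act a (phi (bpure a' x))].
End ChangeOfRings.

Section ExternalTensor.
Variables (A B : finAlg K) (M : fgmod A) (N : fgmod B).

Lemma ext_actP : @is_action (tens_alg A B)
  (ktens 'rV[K]_(fg_dim M) 'rV[K]_(fg_dim N)) (kact (@fg_act A M) (@fg_act B N)).
Proof.
have [Mb M1 MM] := fg_actP M; have [Nb N1 NM] := fg_actP N.
have [ar al] : bilinear_map (kact (@fg_act A M) (@fg_act B N)).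
  exact: kact_bilin.
split=> //.
  apply: (kpure_ext (f := kact _ _ (ta_one A B)) (g := id)) => //.
  by move=> x y; rewrite kactE // M1 N1.
have [mr ml] := ta_bilin A B; move=> s t z.
apply: (kpure_ext (f := fun s => kact _ _ (ta_mul s t) z)
                  (g := fun s => kact _ _ s (kact _ _ t z))).
- by move=> c x y; rewrite ml al.
- exact: al.
move=> a b.
apply: (kpure_ext (f := fun t => kact _ _ (ta_mul (kpure a b) t) z)
                  (g := fun t => kact _ _ (kpure a b) (kact _ _ t z))).
- by move=> c x y; rewrite mr al.
- by move=> c x y; rewrite al ar.
move=> a' b'.
apply: (kpure_ext (f := kact _ _ (ta_mul (kpure a b) (kpure a' b')))
         (g := fun z => kact _ _ (kpure a b) (kact _ _ (kpure a' b') z))).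
- exact: ar.
- by move=> c x y; rewrite !ar.
by move=> x y; rewrite ta_mulE !kactE // MM NM.
Qed.

(* M (x) N, with (a (x) b) . (x (x) y) = a x (x) b y. *)
Definition ext_tens : fgmod (tens_alg A B) := fg_of ext_actP.
End ExternalTensor.

Section Grothendieck.
Variables (B : finAlg K) (Q : fgmod B -> Prop).

Record gobj := GObj { gobj_mod :> fgmod B; gobjP : Q gobj_mod }.
HB.instance Definition _ := gen_eqMixin gobj.
HB.instance Definition _ := gen_choiceMixin gobj.

Variant ses_rel : {freeg gobj} -> Prop :=
| SesRel (L M N : gobj) :
    short_exact L M N -> ses_rel (<< M >> - << L >> - << N >>).

Definition groth : zmodType := pres ses_rel.

(* The class of M. The value 0 when Q M fails is never used below: external
   tensor products of projectives, and their induction and restriction in a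
   tower of algebras, are projective. *)
Definition gcls (M : fgmod B) : groth :=
  if pselect (Q M) is left QM then pres_gen ses_rel (GObj QM) else 0.
End Grothendieck.
End TensorK.

Section Towers.
Variable K : fieldType.

Definition is_graded_unit (A : nat -> finAlg K)
    (rho : forall m n, tens_alg (A m) (A n) -> A (m + n)%N) (e : A 0%N) :=
  forall n (a : A n), rho 0%N n (kpure e a) = a
    /\ ecast i (A i) (addn0 n) (rho n 0%N (kpure a e)) = a.

Record tower := Tower {
  tw :> nat -> finAlg K;
  tw_rho : forall m n, tens_alg (tw m) (tw n) -> tw (m + n)%N;
  tw_assoc : forall m n p (a : tw m) (b : tw n) (c : tw p),
    ecast i (tw i) (addnA m n p)
      (tw_rho (kpure a (tw_rho (kpure b c))))
    = tw_rho (kpure (tw_rho (kpure a b)) c);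
  tw_unit : exists e : tw 0%N, is_graded_unit tw_rho e;
  tw_zero : exists f : tw 0%N -> K^o,
    [/\ linear f, bijective f, f fa_one = 1
      & forall x y, f (fa_mul x y) = f x * f y];
  tw_hom : forall m n, is_alg_hom (@tw_rho m n);
  tw_inj : forall m n, injective (@tw_rho m n);
  tw_projl : forall m n, projective (left_mod (tw_hom m n));
  tw_projr : forall m n, projective (right_mod (tw_hom m n)) }.

Variable A : tower.

Definition tw_rho_at k l n (e : (k + l)%N = n) (t : tens_alg (A k) (A l)) : A n :=
  ecast i (A i) e (tw_rho t).

Lemma tw_rho_atP k l n (e : (k + l)%N = n) : is_alg_hom (tw_rho_at e).
Proof. by case: n / e; apply: tw_hom. Qed.

Section Operations.
(* A class of finitely generated modules over each A_n and A_k (x) A_l. *)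
Variable Q : forall B : finAlg K, fgmod B -> Prop.

Definition grothA (n : nat) : zmodType := groth (@Q (A n)).

Definition clsA n (M : fgmod (A n)) : dsum grothA := dsum_in (gcls (@Q _) M).

Definition is_ind_product (mul : dsum grothA -> dsum grothA -> dsum grothA) :=
  forall m n (M : fgmod (A m)) (N : fgmod (A n)) (W : fgmod (A (m + n)%N)),
    Q M -> Q N -> is_ind (@tw_rho A m n) (ext_tens M N) W ->
    mul (clsA M) (clsA N) = clsA W.

(* The graph of the canonical homomorphism from the tensor product of the
   Grothendieck groups of B and B' to the Grothendieck group of B (x) B',
   [M] (x) [N] |-> [M (x) N]. *)
Definition ext_cls (B B' : finAlg K) (t : tens (groth (@Q B)) (groth (@Q B')))
    (z : groth (@Q (tens_alg B B'))) : Prop :=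
  exists r (c : 'I_r -> int) (M : 'I_r -> fgmod B) (N : 'I_r -> fgmod B'),
    [/\ forall i, Q (M i) /\ Q (N i),
        t = \sum_i tpure (gcls (@Q _) (M i)) (gcls (@Q _) (N i)) *~ c i
      & z = \sum_i gcls (@Q _) (ext_tens (M i) (N i)) *~ c i].

(* Delta [N] is the sum over k + l = n of the [Res N], where the class of Res N
   in the Grothendieck group of A_k (x) A_l is identified with an element
   t k l of the tensor product of those of A_k and A_l. *)
Definition is_res_coproduct
    (comul : dsum grothA -> tens (dsum grothA) (dsum grothA)) :=
  forall n (N : fgmod (A n)), Q N ->
    exists t : forall k l, tens (grothA k) (grothA l),
      (forall k l (e : (k + l)%N = n),
         ext_cls (t k l) (gcls (@Q _) (res (tw_rho_atP e) N)))
      /\ comul (clsA N)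
         = \sum_(k < n.+1) tmap (@dsum_in grothA k) (@dsum_in grothA (n - k)%N)
                             (t k (n - k)%N).
End Operations.

Definition all_mod (B : finAlg K) (M : fgmod B) : Prop := True.
Definition proj_mod (B : finAlg K) (M : fgmod B) : Prop := projective M.

Definition G_gr : nat -> zmodType := grothA all_mod.
Definition K_gr : nat -> zmodType := grothA proj_mod.

Definition is_hom_pairing (pr : dsum K_gr -> dsum G_gr -> int) : Prop :=
  (forall n (P M : fgmod (A n)), projective P ->
     pr (clsA proj_mod P) (clsA all_mod M) = (\dim (mod_Hom P M))%:Z)
  /\ (forall m n (P : fgmod (A m)) (M : fgmod (A n)), projective P -> m != n ->
     pr (clsA proj_mod P) (clsA all_mod M) = 0).

(* The operations on G(A) and K(A) and the pairing are determined by their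
   values on classes of modules. *)
Definition graded_dual_hopf_pair : Prop :=
  exists (DG : hopf_data (dsum G_gr)) (DK : hopf_data (dsum K_gr))
         (pr : dsum K_gr -> dsum G_gr -> int),
    [/\ is_ind_product (hmul DG) /\ is_res_coproduct (hcomul DG),
        is_ind_product (hmul DK) /\ is_res_coproduct (hcomul DK),
        is_hom_pairing pr,
        is_graded_hopf DG /\ is_graded_hopf DK
      & is_graded_dual DK DG pr].
End Towers.

(* Main.v *)
Require Import Defs.
From HB Require Import structures.
From mathcomp Require Import all_boot all_order all_algebra.
From mathcomp Require Import reals complex.
From mathcomp Require Import boolp freeg.

(**
Let [x_n] in [K(A)] and [y_n] in [G(A)] be the classes of the regular module
[A_n]. Inducing a regular module gives a regular module, so
[x_m x_n = x_(m+n)] and [y_m y_n = y_(m+n)], while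
[<x_n, y_n> = dim End(A_n) = dim A_n]. Since [A_0] is the ground field, [G(A)] is
connected: its degree 0 part is generated by the unit [y_0], hence [y_1] is
primitive. Pairing [x_1 x_n] with [y_1 ^ (n+1)] through the coproduct, only the
term of [Delta(y_1 ^ (n+1))] with left factor of degree 1,
[(n+1) y_1 (x) y_1 ^ n], contributes, so
[dim A_(n+1) = (n+1) dim A_1 dim A_n].
*)

Set Implicit Arguments.
Unset Strict Implicit.
Unset Printing Implicit Defensive.

Import GRing.Theory.

Local Open Scope ring_scope.
Local Open Scope quotient_scope.

(** * Additive maps and abelian groups given by generators and relations *)

Section ZmodMorphism.
Variables (U V : zmodType) (f : U -> V).
Hypothesis fB : zmod_morphism f.

Let g : {additive U -> V} := HB.pack f (GRing.isZmodMorphism.Build U V f fB).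

Lemma zmod_morphism0 : f 0 = 0. Proof. exact: (raddf0 g). Qed.
Lemma zmod_morphismD : {morph f : x y / x + y}. Proof. exact: (raddfD g). Qed.
Lemma zmod_morphismMn n : {morph f : x / x *+ n}. Proof. exact: (raddfMn g). Qed.
Lemma zmod_morphismMz n : {morph f : x / x *~ n}. Proof. exact: (raddfMz g). Qed.
End ZmodMorphism.

Lemma morphD_zmod (U V : zmodType) (f : U -> V) :
  {morph f : x y / x + y} -> zmod_morphism f.
Proof.
by move=> fD x y; apply: (addIr (f y)); rewrite -fD !subrK.
Qed.

Lemma linear_zmod (K : fieldType) (U V : lmodType K) (f : U -> V) :
  linear f -> zmod_morphism f.
Proof. by move=> lf; apply: morphD_zmod => x y; have := lf 1 x y; rewrite !scale1r. Qed.

(** Closure under subtraction, together with 0, already gives negation and addition, hence all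
    integer multiples of the generators and their sums. *)
Lemma freeg_zmod_ind (X : choiceType) (P : {freeg X} -> Prop) :
  P 0 -> (forall y z, P y -> P z -> P (y - z)) -> (forall x, P << x >>) ->
  forall D, P D.
Proof.
move=> P0 PB PU; have PN y : P y -> P (- y) by move=> /(PB _ _ P0); rewrite sub0r.
have PD y z : P y -> P z -> P (y + z).
  by move=> Py /PN Pz; rewrite -[z]opprK; apply: PB.
apply: freeg_ind_dom0 => // k x D _ _; apply: (PD).
have Pn n : P (<< x >> *+ n).
  by elim: n => [|n IH]; rewrite ?mulr0n // mulrS; apply: PD.
have -> : << k *g x >> = << x >> *~ k :> {freeg X} by rewrite freegU_mulz intz.
by case: k => n; [apply: Pn|apply: PN; apply: Pn].
Qed.

Lemma zspanP (V : zmodType) (S : V -> Prop) (x : V) :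
  reflect (zspan S x) (x \in zspanb S).
Proof. by rewrite inE; apply: asboolP. Qed.

Section PresTheory.
Variables (X : choiceType) (S : {freeg X} -> Prop).

Lemma pres_relE r : S r -> \pi_(pres S) r = 0.
Proof.
move=> Sr; rewrite -(raddf0 (\pi_(pres S))); apply/eqP.
rewrite -Quotient.idealrBE subr0; apply/zspanP => P _ _; exact.
Qed.

Lemma pres_ind (P : pres S -> Prop) :
  P 0 -> (forall y z, P y -> P z -> P (y - z)) ->
  (forall x, P (pres_gen S x)) -> forall u, P u.
Proof.
move=> P0 PB PG u; rewrite -[u]reprK; elim/freeg_zmod_ind: (repr u) => [|y z Py Pz|x].
- by rewrite raddf0.
- by rewrite raddfB; apply: PB.
- exact: PG.
Qed.

Lemma pres_ext (W : zmodType) (f g : pres S -> W) :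
  zmod_morphism f -> zmod_morphism g ->
  (forall x, f (pres_gen S x) = g (pres_gen S x)) -> f =1 g.
Proof.
move=> fB gB fg; elim/pres_ind => // [|y z fy fz]; first by rewrite !zmod_morphism0.
by rewrite fB gB fy fz.
Qed.

(** [pres_lift] evaluates at the representative [repr u], so all three terms are compared at one
    element of the free group. This yields additivity of nested lifts in their outer arguments. *)
Lemma pres_liftB (W : zmodType) (f g : X -> W) (u : pres S) :
  pres_lift (fun x => f x - g x) u = pres_lift f u - pres_lift g u.
Proof.
rewrite /pres_lift; elim/freeg_zmod_ind: (repr u) => [|y z Ey Ez|x].
- by rewrite !(raddf0 (fgext _)) subr0.
- by rewrite !(raddfB (fgext _)) /= Ey Ez !opprD !opprK addrACA.
- by rewrite !fgextU.
Qed.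
End PresTheory.

(** * Tensor products over the integers and their componentwise product *)

Section TensTheory.
Variables U V : zmodType.

Lemma tpure_biadditive : biadditive (@tpure U V).
Proof.
split=> [u|v]; apply: morphD_zmod => a b; apply/eqP; rewrite -subr_eq0 opprD addrA.
  have /pres_relE := TensDr u a b; rewrite !raddfB => /eqP; exact.
have /pres_relE := TensDl a b v; rewrite !raddfB => /eqP; exact.
Qed.

Lemma tliftB (W : zmodType) (f g : U -> V -> W) t :
  tlift (fun u v => f u v - g u v) t = tlift f t - tlift g t.
Proof. exact: pres_liftB. Qed.

Lemma eq_tlift (W : zmodType) (f g : U -> V -> W) :
  (forall u v, f u v = g u v) -> tlift f =1 tlift g.
Proof. by move=> fg t; congr tlift; apply/funext => u; apply/funext => v. Qed.
End TensTheory.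

Section TensMul.
Variables (H : zmodType) (mul : H -> H -> H).
Hypothesis mulD : biadditive mul.

Lemma tens_mul_inner a b :
  biadditive (fun c d => tpure (mul a c) (mul b d)).
Proof.
have [tr tl] := tpure_biadditive H H.
by split=> [c|d] x y; rewrite mulD.1 ?tr ?tl.
Qed.

Lemma tens_mul_outer t : biadditive
  (fun a b => tlift (fun c d => tpure (mul a c) (mul b d)) t).
Proof.
have [tr tl] := tpure_biadditive H H.
by split=> [a|b] x y; rewrite -tliftB; apply: eq_tlift => c d; rewrite mulD.2 ?tr ?tl.
Qed.

Lemma tens_mul_biadditive : biadditive (tens_mul mul).
Proof.
split=> [s x y|t]; last exact: tlift_additive (tens_mul_outer t).
rewrite -tliftB; apply: eq_tlift => a b.
exact: tlift_additive (tens_mul_inner a b) _ _.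
Qed.

Lemma tens_mulE a b c d :
  tens_mul mul (tpure a b) (tpure c d) = tpure (mul a c) (mul b d).
Proof.
by rewrite /tens_mul (tlift_pure (tens_mul_outer _)) (tlift_pure (tens_mul_inner _ _)).
Qed.
End TensMul.

(** * Powers of a primitive element and their pairings *)

Section Primitive.
Variables (H : zmodType) (D : hopf_data H) (y : H) (Y : nat -> H).
Hypothesis hopfD : is_hopf D.
Hypothesis primy : hcomul D y = tpure (hone D) y + tpure y (hone D).
Hypothesis Y0 : Y 0%N = hone D.
Hypothesis YS : forall n, Y n.+1 = hmul D y (Y n).

(** A truncated binomial formula: only the terms whose left factor is the unit or [y] are kept
    exactly, and [r] absorbs those whose left factor is a power of exponent at least 2. The
    induction multiplies by the coproduct of [y]. *)
Lemma comul_primitive_pow n : exists r,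
  [/\ zspan (fun t => exists k b, t = tpure (Y k.+2) b) r
    & hcomul D (Y n.+1)
      = tpure (hone D) (Y n.+1) + tpure y (Y n) *+ n.+1 + r].
Proof.
have mulD := hopf_mulD hopfD; have [mr ml] := tens_mul_biadditive mulD.
have [mul1 mulr1] := (hopf_mul1l hopfD, hopf_mul1r hopfD).
have Y1 : Y 1%N = y by rewrite YS Y0 mulr1.
have Y2 : Y 2%N = hmul D y y by rewrite YS Y1.
elim: n => [|n [r [rP E]]].
  by exists 0; split=> [P //|]; rewrite Y1 Y0 primy addr0.
set S := (fun t => _) in rP *.
have mulS a b k c d : hmul D a (Y k.+2) = Y c.+2 ->
   S (tens_mul (hmul D) (tpure a b) (tpure (Y k.+2) d)).
  by move=> e; rewrite tens_mulE // e; exists c; eexists.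
have spanM a b : (forall k, exists c, hmul D a (Y k.+2) = Y c.+2) ->
    zspan S (tens_mul (hmul D) (tpure a b) r).
  move=> aS; pose P t := zspan S (tens_mul (hmul D) (tpure a b) t).
  apply: (rP P) => [|s t Ps Pt|_ [k [d ->]]]; rewrite /P.
  - by rewrite (zmod_morphism0 (mr _)) => ?.
  - by rewrite mr; apply/zspanP; rewrite rpredB //; apply/zspanP.
  - by case: (aS k) => c e ? _ _; apply; apply: mulS e.
(* The new remainder: [y (x) 1] raises the old linear term to left exponent 2, and both summands of
   the coproduct of [y] keep [r] in the span. The one new linear term comes from [y (x) 1] times
   [1 (x) Y n.+1]. *)
exists (tpure (Y 2) (Y n) *+ n.+1 + (tens_mul (hmul D) (tpure (hone D) y) r
   + tens_mul (hmul D) (tpure y (hone D)) r)); split.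
  apply/zspanP; rewrite !rpredD ?rpredMn //; apply/zspanP.
  - by move=> P _ _; apply; exists 0%N, (Y n).
  - by apply: spanM => k; exists k; rewrite mul1.
  - by apply: spanM => k; exists k.+1; rewrite -YS.
rewrite {1}YS (hopf_comulM hopfD) primy E.
rewrite (zmod_morphismD (ml _)) !(zmod_morphismD (mr _)) !(zmod_morphismMn (mr _)).
rewrite !tens_mulE // !mul1 !mulr1 -!YS -Y2.
rewrite [in RHS]mulrSr -!addrA; do 2!congr (_ + _).
by rewrite addrCA; congr (_ + _); rewrite addrCA.
Qed.

(** Through the coproduct, [x] is paired with the left factors. It kills [Y 0] and every [Y k.+2],
    so only the linear term of the binomial formula survives. *)
Lemma pairing_primitive_pow (H' : zmodType) (D' : hopf_data H')
    (pr : H' -> H -> int) (x z : H') n :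
  biadditive pr ->
  (forall x x' u, pr (hmul D' x x') u = tens_pairing pr (tpure x x') (hcomul D u)) ->
  (forall k, k != 1%N -> pr x (Y k) = 0) ->
  pr (hmul D' x z) (Y n.+1) = pr x y * pr z (Y n) *+ n.+1.
Proof.
move=> [prr prl] prM pr0.
have inner a b : biadditive (fun c d => pr a c * pr b d).
  by split=> [c|d] s t; rewrite prr ?mulrBr ?mulrBl.
rewrite prM /tens_pairing (tlift_pure (f := fun a b => tlift _ _)); last first.
  split=> [a|b] s t; rewrite -tliftB; apply: eq_tlift => c d;
  by rewrite prl ?mulrBr ?mulrBl.
have [r [rP ->]] := comul_primitive_pow n.
have lB := tlift_additive (inner x z).
rewrite !(zmod_morphismD lB) (zmod_morphismMn lB) !(tlift_pure (inner _ _)).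
(* Reading the unit as [Y 0] makes the first term vanish; what remains is that the remainder pairs
   to 0. *)
rewrite -Y0 pr0 // mul0r add0r; apply/eqP; rewrite -subr_eq0 addrC addKr; apply/eqP.
set f := tlift _ in lB *; apply: (rP (fun r => f r = 0)) => [|s t es et|_ [k [b ->]]].
- exact: zmod_morphism0.
- by rewrite lB es et subr0.
- by rewrite /f (tlift_pure (inner _ _)) pr0 // mul0r.
Qed.
End Primitive.

(** * Degree 1 of a connected graded Hopf algebra *)

Lemma dsum_in_additive (G : nat -> zmodType) n : zmod_morphism (@dsum_in G n).
Proof.
move=> x y; apply: dsum_inj => m /=.
case: (eqVneq n m) => [e|ne]; last by rewrite !dfwith_out // subr0.
by case: m / e; rewrite !dfwith_in.
Qed.

(** The coproduct of [y] lies in bidegrees (0,1) and (1,0). Since degree 0 consists of multiples of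
    the unit, it has the form [1 (x) b + b' (x) 1], and the counit axioms identify [b] and [b']. *)
Lemma degree1_primitive (H : nat -> zmodType) (D : hopf_data (dsum H)) :
  is_graded_hopf D -> (forall a : H 0, exists k, dsum_in a = hone D *~ k) ->
  forall y : H 1, hcomul D (dsum_in y)
    = tpure (hone D) (dsum_in y) + tpure (dsum_in y) (hone D).
Proof.
move=> gD gen0 y; have hD := ghopf_hopf gD.
have [tr tl] := tpure_biadditive (dsum H) (dsum H).
have eB := hopf_counitD hD.
pose P t := exists b b' : H 1,
  t = tpure (hone D) (dsum_in b) + tpure (dsum_in b') (hone D).
have [b [b' E]] : P (hcomul D (dsum_in y)).
  apply: (ghopf_comul gD y) => [|s t|t [k [l [a [b]]]]].
  - exists 0, 0; rewrite (zmod_morphism0 (@dsum_in_additive H 1)).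
    by rewrite (zmod_morphism0 (tr _)) (zmod_morphism0 (tl _)) addr0.
  - move=> [b [b' ->]] [c [c' ->]]; exists (b - c), (b' - c'); rewrite !dsum_in_additive tr tl.
    by rewrite opprD addrACA.
  case: k l a b => [|[|k]] [|[|l]] a b [] // _ ->.
  - have [k ->] := gen0 a; exists (b *~ k), 0.
    rewrite (zmod_morphism0 (@dsum_in_additive H 1)) (zmod_morphism0 (tl _)) addr0.
    rewrite (zmod_morphismMz (@dsum_in_additive H 1)).
    by rewrite (zmod_morphismMz (tl _)) (zmod_morphismMz (tr _)).
  - have [k ->] := gen0 b; exists 0, (a *~ k).
    rewrite (zmod_morphism0 (@dsum_in_additive H 1)) (zmod_morphism0 (tr _)) add0r.
    rewrite (zmod_morphismMz (@dsum_in_additive H 1)).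
    by rewrite (zmod_morphismMz (tl _)) (zmod_morphismMz (tr _)).
have bl : biadditive (fun a b : dsum H => b *~ hcounit D a).
  by split=> [u|v] s t; rewrite ?mulrzBl // eB mulrzBr.
have br : biadditive (fun a b : dsum H => a *~ hcounit D b).
  by split=> [u|v] s t; rewrite ?mulrzBl // eB mulrzBr.
(* The counit is 1 on the unit and 0 in degree 1, so the left axiom isolates [b] and the right one
   [b']; both equal [y]. *)
have := hopf_counitl hD (dsum_in y); have := hopf_counitr hD (dsum_in y).
rewrite E (zmod_morphismD (tlift_additive bl)) (zmod_morphismD (tlift_additive br)).
rewrite !(tlift_pure bl) !(tlift_pure br) (hopf_counit1 hD) !(ghopf_counit gD) //.
by rewrite !mulr0z !mulr1z addr0 add0r => -> ->.
Qed.

(** * Regular modules: projectivity, endomorphisms and induction *)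

Section Regular.
Variable K : fieldType.

Definition reg_mod (B : finAlg K) : fgmod B := fg_of (reg_actP B).

(** A map out of the regular module is determined by the image of 1, so a lift is obtained by
    choosing a preimage [m] of [f 1] and sending [x] to [x m]. *)
Lemma projective_reg (B : finAlg K) : projective (reg_mod B).
Proof.
move=> M N g f [lg gM] sg [lf fM]; have [m gm] := sg (f (coords fa_one)).
have [[ar al] a1 aM] := mod_actP M.
exists (fun x => mod_act (uncoords x : B) m); split=> [|x].
  split=> [c x y|b x]; first by rewrite uncoords_linear al.
  by rewrite /= /fg_act /= coordsK aM.
by rewrite gM gm -fM /= /fg_act /= coordsK fa_mul1r uncoordsK.
Qed.

(** Right multiplications identify [B] with the endomorphisms of its left regular module; evaluation
    at 1 is the inverse. *)
Lemma dim_mod_Hom_reg (B : finAlg K) :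
  \dim (mod_Hom (reg_mod B) (reg_mod B)) = \dim {:B}.
Proof.
have [mr ml] := fa_bilin B.
pose rmul (b : B) (x : 'rV[K]_(\dim {:B})) : 'rV[K]_(\dim {:B}) :=
  coords (fa_mul (uncoords x) b).
have rmul_lin b : linear (rmul b).
  by move=> c x y; rewrite /rmul uncoords_linear ml coords_linear.
pose phi (b : B) := linfun (rmul b).
have phiE b x : phi b x = rmul b x by rewrite linfunE.
have phi_lin : linear phi.
  move=> c a b; apply/lfunP => x.
  by rewrite add_lfunE scale_lfunE !phiE /rmul mr coords_linear.
have phi_inj : (fullv :&: lker (linfun phi) = 0)%VS.
  rewrite capfv; apply/eqP/lker0P => a b; rewrite !linfunE // => /lfunP e.
  have := e (coords fa_one); rewrite !phiE /rmul coordsK !fa_mul1l.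
  exact: (can_inj (@coordsK _ _)).
rewrite -(limg_dim_eq phi_inj); congr (\dim _); apply/vspaceP => f.
apply/idP/memv_imgP => [/mod_HomP[_ fM]|[b _ ->]].
  exists (uncoords (f (coords fa_one))); first exact: memvf.
  rewrite linfunE //; apply/lfunP => x; rewrite phiE /rmul.
  have := fM (uncoords x) (coords fa_one).
  by rewrite /= /fg_act /= coordsK fa_mul1r uncoordsK.
apply/mod_HomP; rewrite linfunE //; split=> [|a x]; first exact: linearP.
by rewrite !phiE /rmul /= /fg_act /= !coordsK fa_mulA.
Qed.

Section Induction.
Variables (B B' : finAlg K) (f : B -> B').
Hypothesis fP : is_alg_hom f.

Lemma bpure_biadditive (M : fgmod B) : biadditive (@bpure K B B' f M).
Proof.
split=> [a|x]; apply: morphD_zmod => y z; apply/eqP; rewrite -subr_eq0 opprD addrA.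
  have /pres_relE := BalDr f a y z; rewrite !raddfB => /eqP; exact.
have /pres_relE := @BalDl _ _ _ f M y z x; rewrite !raddfB => /eqP; exact.
Qed.

Lemma bpureM (M : fgmod B) a b (x : M) :
  bpure f (fa_mul a (f b)) x = bpure f a (fg_act b x).
Proof.
apply/eqP; rewrite -subr_eq0.
have /pres_relE := @BalM _ _ _ f M a b x; rewrite !raddfB => /eqP; exact.
Qed.

(** This is the isomorphism of [B' (x)_B B] with [B'], by [a (x) x |-> a f(psi x)]. Passing through
    [psi] allows [M] to be the regular module only up to isomorphism. *)
Lemma is_ind_free1 (M : fgmod B) (psi : M -> B) :
  linear psi -> bijective psi ->
  (forall b x, psi (fg_act b x) = fa_mul b (psi x)) ->
  is_ind f M (reg_mod B').
Proof.
move=> lpsi [psi' psiK psi'K] psiM; have [lf f1 fM] := fP.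
have [mr ml] := fa_bilin B'; have [bpr bpl] := bpure_biadditive M.
pose F (p : B' * 'rV[K]_(fg_dim M)) : reg_mod B' := coords (fa_mul p.1 (f (psi p.2))).
have FS r : @bal_rel K B B' f M r -> fgext F r = 0.
  have Fl x : zmod_morphism (fun a => F (a, x)).
    by move=> a b; rewrite /F (linear_zmod (ml _)) (linear_zmod (@coords_linear _ _)).
  have Fr a : zmod_morphism (fun x => F (a, x)).
    move=> x y; rewrite /F /= (linear_zmod lpsi) (linear_zmod lf) (linear_zmod (mr _)).
    exact: (linear_zmod (@coords_linear _ _)).
  case=> [a b x|a x y|a b x]; rewrite !(raddfB (fgext F)) /= !fgextU.
  - by rewrite (zmod_morphismD (Fl x)) addrAC addrK subrr.
  - by rewrite (zmod_morphismD (Fr a)) addrAC addrK subrr.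
  - by rewrite /F /= psiM fM fa_mulA subrr.
have phiB := pres_lift_additive FS.
have phiE a x : pres_lift F (bpure f a x) = F (a, x) := pres_lift_gen FS (a, x).
exists (pres_lift F); split=> //.
  exists (fun v => bpure f (uncoords v) (psi' fa_one)) => [|v]; last first.
    by rewrite phiE /F /= psi'K f1 fa_mul1r uncoordsK.
  apply: pres_ext => [u v|//|[a x]].
    by rewrite phiB (linear_zmod (@uncoords_linear _ _)) bpl.
  (* Balancing moves [f (psi x)] across the tensor sign, where [psi x] acting on [psi' 1] gives back
     [x]. *)
  rewrite [pres_lift _ _]phiE /F /= coordsK bpureM.
  congr (bpure f a _); apply: (can_inj psiK).
  by rewrite psiM psi'K fa_mul1r.
by move=> a a' x; rewrite !phiE /F /= /fg_act /= coordsK fa_mulA.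
Qed.
End Induction.

(** The external tensor product of two regular modules is the regular module of the tensor algebra,
    so the rank one free case applies. *)
Lemma is_ind_reg (A B C : finAlg K) (f : tens_alg A B -> C) :
  is_alg_hom f -> is_ind f (ext_tens (reg_mod A) (reg_mod B)) (reg_mod C).
Proof.
move=> fP.
have bilin_kpure (U V U' V' : vectType K) (g : U -> U') (h : V -> V') :
    linear g -> linear h -> bilinear_map (fun u v => kpure (g u) (h v)).
  have [kr kl] := kpure_bilin U' V'.
  by move=> lg lh; split=> [u|v] c x y; rewrite ?lg ?lh ?kr ?kl.
have bu := bilin_kpure _ _ _ _ _ _ (@uncoords_linear _ A) (@uncoords_linear _ B).
have bc := bilin_kpure _ _ _ _ _ _ (@coords_linear _ A) (@coords_linear _ B).
(* Two layers of coordinates separate the module from [tens_alg A B]: [un] removes those of the two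
   factors, and the [uncoords] in [psi] removes those of their tensor product. *)
pose un := klift (fun u v => kpure (uncoords u : A) (uncoords v : B)).
pose co := klift (fun (u : A) (v : B) => kpure (coords u) (coords v)).
have lun : linear un by apply: klift_linear.
have lco : linear co by apply: klift_linear.
have unK : cancel un co.
  apply: kpure_ext => // [c x y|u v]; first by rewrite lun lco.
  by rewrite /un /co !kliftE // !uncoordsK.
have coK : cancel co un.
  apply: kpure_ext => // [c x y|u v]; first by rewrite lco lun.
  by rewrite /un /co !kliftE // !coordsK.
pose M := ext_tens (reg_mod A) (reg_mod B).
pose psi (x : 'rV[K]_(fg_dim M)) : tens_alg A B := un (uncoords x).
apply: (@is_ind_free1 _ _ f fP M psi); rewrite /psi.
- by move=> c x y; rewrite uncoords_linear lun.
- exists (fun t => coords (co t)) => t; first by rewrite unK uncoordsK.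
  by rewrite coordsK coK.
move=> s t; rewrite /= coordsK; set w := uncoords t.
have [Ab _ _] := fg_actP (reg_mod A); have [Bb _ _] := fg_actP (reg_mod B).
have [kr kl] := kact_bilin (@fg_act _ _ (reg_mod A)) (@fg_act _ _ (reg_mod B)).
have [mr ml] := ta_bilin A B.
apply: (kpure_ext (f := fun s => un (kact _ _ s w)) (g := fun s => ta_mul s (un w)));
  [by move=> c x y; rewrite kl lun|exact: ml|move=> a b].
apply: (kpure_ext (f := fun w => un (kact _ _ (kpure a b) w))
  (g := fun w => ta_mul (kpure a b) (un w)));
  [by move=> c x y; rewrite kr lun|by move=> c x y; rewrite lun mr|move=> x y].
by rewrite kactE // /un !kliftE // ta_mulE /= !coordsK.
Qed.
End Regular.

(** * Grothendieck groups, and the case of an algebra isomorphic to the ground field *)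

Section GrothendieckTheory.
Variables (K : fieldType) (B : finAlg K).

Lemma gclsE (Q : fgmod B -> Prop) (M : fgmod B) (QM : Q M) :
  gcls Q M = pres_gen (@ses_rel K B Q) (GObj QM).
Proof.
rewrite /gcls; case: pselect => // QM'.
by rewrite (Prop_irrelevance QM QM').
Qed.

Lemma gcls_ses (Q : fgmod B -> Prop) (L M N : fgmod B) :
  Q L -> Q M -> Q N -> short_exact L M N -> gcls Q M = gcls Q L + gcls Q N.
Proof.
move=> QL QM QN LMN; rewrite !gclsE; apply/eqP; rewrite -subr_eq0 opprD addrA.
have /pres_relE := @SesRel _ _ _ (GObj QL) (GObj QM) (GObj QN) LMN.
rewrite !raddfB => /eqP; exact.
Qed.

Lemma groth_gen (Q : fgmod B -> Prop) (g : groth Q) :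
  (forall M, Q M -> exists k, gcls Q M = g *~ k) ->
  forall u, exists k, u = g *~ k.
Proof.
move=> gen; elim/pres_ind => [|_ _ [k ->] [l ->]|[M QM]].
- by exists 0.
- by exists (k - l); rewrite mulrzBr.
- by rewrite -gclsE; apply: gen.
Qed.

Variable f : B -> K^o.
Hypotheses (lf : linear f) (bf : bijective f) (f1 : f fa_one = 1).
Hypothesis fM : forall x y, f (fa_mul x y) = f x * f y.

Lemma scalar_algE (b : B) : b = (f b : K) *: (fa_one : B).
Proof.
apply: (bij_inj bf); have := lf (f b) fa_one 0.
rewrite !addr0 (zmod_morphism0 (linear_zmod lf)) addr0 f1 => ->.
by rewrite /GRing.scale /= mulr1.
Qed.

Lemma dim_scalar_alg : \dim {:B} = 1%N.
Proof.
have -> : {:B}%VS = <[fa_one]>%VS.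
  apply/vspaceP => b; rewrite memvf; apply/esym/vlineP.
  by exists (f b); apply: scalar_algE.
rewrite dim_vline; case: eqP => // o0; have := f1.
by rewrite o0 (zmod_morphism0 (linear_zmod lf)) => /eqP; rewrite eq_sym oner_eq0.
Qed.

Lemma scalar_mod_actP d : is_action (fun b (x : 'rV[K]_d) => (f b : K) *: x).
Proof.
split=> [|x|a b x]; last by rewrite fM scalerA.
- split=> [b|x] c y z /=; first by rewrite scalerDr !scalerA mulrC.
  by rewrite lf scalerDl scalerA.
- by rewrite f1 scale1r.
Qed.

Definition scalar_mod d : fgmod B := FgMod (scalar_mod_actP d).

(** Equality holds on the nose, not only up to isomorphism: the carrier is always some [K^d], and
    each [b] is the scalar [f b], so its action is forced. *)
Lemma fgmod_scalar (M : fgmod B) : M = scalar_mod (fg_dim M).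
Proof.
case: M => d act actP /=; have [[ar al] a1 aM] := actP.
have e : act = fun b (x : 'rV[K]_d) => (f b : K) *: x.
  apply/funext => b; apply/funext => x; rewrite {1}(scalar_algE b).
  have := al x (f b) fa_one 0; rewrite /= (zmod_morphism0 (linear_zmod (al x))).
  by rewrite !addr0 a1.
rewrite /scalar_mod; move: (scalar_mod_actP d); case: _ / e => actP'.
by congr FgMod; apply: Prop_irrelevance.
Qed.

(** Induction on [d] along the split sequence from [K] through [K^(1+d)] to [K^d]. *)
Lemma gcls_scalar_mod d :
  gcls (@all_mod K B) (scalar_mod d) = gcls (@all_mod K B) (scalar_mod 1) *+ d.
Proof.
elim: d => [|d IH].
  (* The exact sequence whose three terms are all zero gives [[0] = [0] + [0]], hence [[0] = 0]. *)
  apply: (addrI (gcls (@all_mod K B) (scalar_mod 0))).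
  rewrite mulr0n addr0; apply/esym; apply: gcls_ses => //.
  exists id, id; split=> //; [by split..|by move=> y; exists y|].
  by move=> y; split=> _; [exists y|apply/rowP; case].
rewrite -add1n mulrnDr -IH; apply: gcls_ses => //.
exists (fun x : 'rV[K]_1 => row_mx x 0 : 'rV[K]_(1 + d)).
exists (fun x : 'rV[K]_(1 + d) => rsubmx x); split.
- split=> [c x y|b x] /=; first by rewrite scale_row_mx add_row_mx scaler0 addr0.
  by rewrite scale_row_mx scaler0.
- by split=> [c x y|b x] /=; [rewrite linearP|rewrite linearZ].
- by move=> x y /eq_row_mx[].
- by move=> y; exists (row_mx 0 y); rewrite row_mxKr.
- move=> y; split=> [y0|[x <-]]; last by rewrite row_mxKr.
  by exists (lsubmx y); rewrite -[RHS]hsubmxK y0.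
Qed.

Lemma groth_scalar_alg (u : groth (@all_mod K B)) :
  exists k, u = gcls (@all_mod K B) (reg_mod B) *~ k.
Proof.
apply: groth_gen => M _; exists (fg_dim M)%:Z.
rewrite [in LHS](fgmod_scalar M) [in RHS](fgmod_scalar (reg_mod B)).
by rewrite /= dim_scalar_alg gcls_scalar_mod.
Qed.
End GrothendieckTheory.

(** * Recursion for the dimensions in a tower *)

Theorem theorem1p1 (R : realType) (A : tower R[i]) :
  graded_dual_hopf_pair A ->
  forall n : nat, (\dim {: A n} = (\dim {: A 1}) ^ n * n`!)%N.
Proof.
move=> [DG [DK [pr [[indG _] [indK _] [prE pr0] [gG gK] dual]]]].
pose x n := clsA (@proj_mod R[i]) (reg_mod (A n)).
pose y n := clsA (@all_mod R[i]) (reg_mod (A n)).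
(* The degree 1 factor stands on the left because [1 + n] computes to [n.+1], which avoids a
   transport between algebras of the tower. *)
have xS n : x n.+1 = hmul DK (x 1%N) (x n).
  apply/esym/(indK 1%N n); [exact: projective_reg..|].
  exact: is_ind_reg (tw_hom A 1 n).
have yM m n : hmul DG (y m) (y n) = y (m + n)%N.
  by apply: indG => //; apply: is_ind_reg (tw_hom A m n).
have [f [lf bf f1 fM]] := tw_zero A.
have hG := ghopf_hopf gG.
have gen0 (a : G_gr A 0) : exists k, dsum_in a = y 0%N *~ k.
  have [k ->] := groth_scalar_alg lf bf f1 fM a; exists k.
  exact: (zmod_morphismMz (@dsum_in_additive _ _)).
(* The unit is [k] times [y 0], and [y 0] is idempotent; hence [y 0 = 1 * y 0] is [k] times [y 0],
   which is the unit. *)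
have y0 : y 0%N = hone DG.
  have [z oneE] := ghopf_one gG; have [k e] := gen0 z; rewrite -oneE in e.
  have := hopf_mul1l hG (y 0%N).
  by rewrite {1}e (zmod_morphismMz ((hopf_mulD hG).2 _)) yM -e.
have prxy n : pr (x n) (y n) = (\dim {: A n})%:Z.
  by rewrite prE ?dim_mod_Hom_reg //; apply: projective_reg.
have prim : hcomul DG (y 1%N) = tpure (hone DG) (y 1%N) + tpure (y 1%N) (hone DG).
  by apply: degree1_primitive => // a; rewrite -y0.
have step n : (\dim {: A n.+1} = \dim {: A 1} * \dim {: A n} * n.+1)%N.
  apply/eqP; rewrite -eqz_nat -prxy xS.
  rewrite (pairing_primitive_pow hG prim y0 _ _ _ (gdual_biadd dual) (gdual_mul dual)).
  - by rewrite !prxy !PoszM -mulr_natr natz.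
  - by move=> m; rewrite yM.
  - by move=> k k1; apply: pr0; [apply: projective_reg|rewrite eq_sym].
elim=> [|n IH]; first by rewrite (dim_scalar_alg lf bf f1).
by rewrite step IH factS expnS -!mulnA [(n`! * _)%N]mulnC.
Qed.
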